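(* The following statements are equivalent: (1) the Continuum Hypothesis ($2^{\aleph_0}=\aleph_1$); (2) there is a partition $\mathcal{P}\subseteq[\mathbb{R}]^{\le\omega}$ of $\mathbb{R}$ such that for any $\mathcal{A}\subseteq\mathcal{P}$, the set $\bigcup\mathcal{A}$ is $[\mathbb{R}]^{\le\omega}$-nonmeasurable if and only if $\bigcup\mathcal{A}$ is completely $[\mathbb{R}]^{\le\omega}$-nonmeasurable.
   Context: $[\mathbb{R}]^{\le\omega}$ denotes the $\sigma$-ideal of all countable (finite or countably infinite) subsets of $\mathbb{R}$. For a $\sigma$-ideal $\mathcal{I}$ of subsets of $\mathbb{R}$, a set $A\subseteq\mathbb{R}$ is $\mathcal{I}$-nonmeasurable if it does not belong to the $\sigma$-algebra generated by the Borel sets and $\mathcal{I}$; it is completely $\mathcal{I}$-nonmeasurable if $A\cap B$ is $\mathcal{I}$-nonmeasurable for every Borel set $B\notin\mathcal{I}$. A partition of $\mathbb{R}$ is a family of nonempty pairwise disjoint sets with union $\mathbb{R}$. *)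

(* Defs.v *)
From mathcomp Require Import all_boot all_order all_algebra.
From mathcomp Require Import all_classical all_reals all_analysis.

Set Implicit Arguments.
Unset Strict Implicit.
Unset Printing Implicit Defensive.

Local Open Scope classical_set_scope.
Local Open Scope card_scope.

(* [r] has order type omega_1, the least uncountable ordinal; [r] is reflexive,
   so the initial segments below are closed. *)
Definition omega1_order (T : Type) (r : rel T) : Prop :=
  [/\ wochoice.well_order r,
      ~ countable [set: T] &
      forall x : T, countable [set y | r y x]].

Definition has_card_aleph1 (U : Type) (A : set U) : Prop :=
  exists (T : Type) (r : rel T), omega1_order r /\ A #= [set: T].

Definition continuum_hypothesis : Prop := has_card_aleph1 [set: nat -> bool].

Definition countable_ideal (R : realType) : set (set R) :=
  [set A | countable A].
Arguments countable_ideal R : clear implicits.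

(* The Borel sets are the sets measurable for the canonical sigma-algebra on R,
   generated by half-open intervals; see [RGenOpens.measurableE] for the
   equality with the sigma-algebra generated by the open sets. *)
Definition borel_sets (R : realType) : set (set R) :=
  @measurable _ (measurableTypeR R).
Arguments borel_sets R : clear implicits.

Definition ideal_nonmeasurable (R : realType) (I : set (set R))
    (A : set R) : Prop :=
  ~ <<s borel_sets R `|` I >> A.

Definition completely_ideal_nonmeasurable (R : realType) (I : set (set R))
    (A : set R) : Prop :=
  forall B : set R, borel_sets R B -> ~ I B -> ideal_nonmeasurable I (A `&` B).

(* Main.v *)
Require Import Defs.
From mathcomp Require Import all_boot all_order all_algebra.
From mathcomp Require Import all_classical all_reals all_analysis.
From mathcomp Require Import measurable_realfun zify.

(** Countable sets being Borel, a set is nonmeasurable exactly when it is not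
    Borel, and it is completely nonmeasurable exactly when it and its complement
    meet every uncountable Borel set (a Bernstein set).

    Assume the continuum hypothesis. A Borel set is described by a well-founded
    tree of operations, hence by a function from finite sequences to [nat], so
    that both the reals and the Borel sets can be enumerated along [omega_1]
    ([real_enumeration], [borel_enumeration]). A transfinite recursion then
    builds countable disjoint blocks, indexed by [omega_1], such that the block
    of rank [t] meets the uncountable Borel sets enumerated up to [t]
    ([omega1_blocks]). Consider a union of blocks. If countably many blocks are
    used, or countably many are left out, the union is countable or
    cocountable, hence Borel. Otherwise both the union and its complement
    contain blocks of arbitrarily large rank, so they both meet every
    uncountable Borel set.

    Conversely, consider a partition into countable blocks whose unions are
    Borel or completely nonmeasurable. The initial segments of a well-order of
    the reals in which every block is convex yield a union [X] of blocks that
    has size [aleph_1] ([aleph1_saturated]). It remains to see that [X] has the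
    size of the continuum ([continuum_le]). If [X] is Borel, this is the perfect
    set theorem for Borel sets ([borel_perfect]). If [X] is completely
    nonmeasurable, it meets each of continuum many disjoint uncountable Borel
    sets ([continuum_many_borel]), which are found by applying the perfect set
    theorem to the whole line.

    The perfect set theorem is proved in the Cantor space, to which the reals
    are transferred by Dedekind cuts. Borel sets are projections of
    closed sets ([cantor_borel_analytic]). An uncountable projection of a closed
    set contains a binary tree of approximations (of a point together with its
    witness) that keep uncountably many points and separate these points
    ([big_split]); the branches of this tree converge because the relation is
    closed. *)

Set Implicit Arguments.
Unset Strict Implicit.
Unset Printing Implicit Defensive.

Import Order.TTheory GRing.Theory Num.Theory.

Local Open Scope classical_set_scope.
Local Open Scope card_scope.

(** * Countable sets *)

Lemma set_inj_card_le (T U : Type) (A : set T) (B : set U) (f : T -> U) :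
  {in A &, injective f} -> (forall x, A x -> B (f x)) -> A #<= B.
Proof.
move=> f_inj fAB; apply: (@card_le_trans _ _ _ (f @` A)).
  by have := inj_card_eq f_inj; rewrite card_eq_le => /andP[].
by apply: subset_card_le => _ [x Ax <-]; exact: fAB.
Qed.

Lemma countable_subset (T : Type) (A B : set T) :
  A `<=` B -> countable B -> countable A.
Proof. by move=> /subset_card_le AB; exact: sub_countable. Qed.

Lemma countable_setU (T : Type) (A B : set T) :
  countable A -> countable B -> countable (A `|` B).
Proof.
by move=> cA cB; rewrite -bigcup2E; apply: bigcup_countable => // -[|[|n]].
Qed.

(** * Well-orders *)

Section WellOrder.
Variables (T : Type) (r : rel T).
Hypothesis wo : wochoice.well_order r.

Lemma well_order_min (A : set T) :
  A !=set0 -> exists2 m, A m & forall x, A x -> r m x.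
Proof.
move=> [a Aa]; have [|m [[Am minm] _]] := @wo [pred x | `[< A x >]].
  by exists a; apply/asboolP.
exists m; first by move/asboolP: Am.
by move=> x Ax; apply: minm; apply/asboolP.
Qed.

Lemma well_order_refl : reflexive r.
Proof.
move=> x; have [|m -> /(_ x)] := @well_order_min [set x]; last exact.
by exists x.
Qed.

Lemma well_order_total : total r.
Proof.
move=> x y; have [|m [->|->] mmin] := @well_order_min [set x; y].
- by exists x; left.
- by rewrite mmin//; right.
- by rewrite (mmin x) ?orbT//; left.
Qed.

Lemma well_order_anti : antisymmetric r.
Proof.
move=> x y /andP[xy yx].
have [|m [_ muniq]] := @wo [pred z | `[< z = x \/ z = y >]].
  by exists x; apply/asboolP; left.
suff mE z : z = x \/ z = y -> m = z.
  by rewrite -(mE x (or_introl erefl)); apply: mE; right.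
move=> zxy; apply: muniq; split; first exact/asboolP.
by move=> t /asboolP txy; case: zxy => ->; case: txy => ->;
  rewrite // well_order_refl.
Qed.

(** Stated for the relation [~ r y x], which is the strict order of [r]
    by totality, so that [Fix] can be used along [r]. *)
Lemma well_order_wf : well_founded (fun x y => ~ r y x).
Proof.
move=> x; apply: contrapT => nx.
have [|m nm mmin] := @well_order_min [set z | ~ Acc (fun x y => ~ r y x) z].
  by exists x.
by apply: nm; constructor => y nmy; apply: contrapT => /mmin.
Qed.

End WellOrder.

Lemma well_orderI (T : Type) (r : rel T) : antisymmetric r ->
  (forall A : set T, A !=set0 -> exists2 m, A m & forall x, A x -> r m x) ->
  wochoice.well_order r.
Proof.
move=> ranti rmin; apply: wochoice.antisymmetric_well_order => // A [a Aa].
have [|m Am mmin] := rmin [set x | x \in A]; first by exists a.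
by exists m; split.
Qed.

(** An uncountable well-ordered set has an initial segment of order
    type [omega_1]: the points with only countably many predecessors. It
    is uncountable, for otherwise the least point outside it would have
    countably many predecessors. *)
Lemma well_order_aleph1 (T : Type) (r : rel T) : wochoice.well_order r ->
  ~ countable [set: T] ->
  let S := [set x | countable [set y | r y x]] in
  ~ countable S /\ has_card_aleph1 S.
Proof.
move=> wo ncT S.
have ncS : ~ countable S.
  move=> cS; have [|m nSm mmin] := @well_order_min _ _ wo (~` S).
    by apply/set0P/eqP => S0; apply: ncT; rewrite -setC0 -S0 setCK.
  apply: nSm; apply: (@countable_subset _ _ (S `|` [set m])).
    move=> y /= ym; have [Sy|/mmin my] := pselect (S y); [by left|right].
    by apply: (well_order_anti wo); rewrite ym my.
  by apply: countable_setU => //; exact: countable1.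
split => //; exists S, (fun x y => r (val x) (val y)); split; last first.
  exact: card_setT_sym.
split.
- apply: well_orderI => [x y /(well_order_anti wo)/val_inj//|A [a Aa]].
  have [|_ [b Ab <-] bmin] := @well_order_min _ _ wo (val @` A).
    by exists (val a), a.
  by exists b => // x Ax; apply: bmin; exists x.
- by rewrite (eq_countable (card_setT _)).
- move=> x; apply: (@sub_countable _ _ _ [set y | r y (val x)]); last first.
    exact: (set_mem (valP x)).
  by apply: (@set_inj_card_le _ _ _ _ val) => // y z _ _; exact: val_inj.
Qed.

(** Comparing first the values of [m] and then the points themselves keeps a
    well-order and makes every fibre of [m] convex. *)
Definition fibre_order (T : Type) (r : rel T) (m : T -> T) : rel T :=
  fun x y => if `[< m x = m y >] then r x y else r (m x) (m y).

Lemma fibre_order_wo (T : Type) (r : rel T) (m : T -> T) :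
  wochoice.well_order r -> wochoice.well_order (fibre_order r m).
Proof.
move=> wo; apply: well_orderI => [x y|A [a Aa]].
  rewrite /fibre_order (_ : `[< m y = m x >] = `[< m x = m y >]); last first.
    by apply: asbool_equiv_eq; split.
  by case: asboolP => [_|nm] /(well_order_anti wo).
have [|_ [b Ab <-] bmin] := @well_order_min _ _ wo (m @` A).
  by exists (m a), a.
have [|c [Ac mc] cmin] := @well_order_min _ _ wo (A `&` m @^-1` [set m b]).
  by exists b.
exists c => // x Ax; rewrite /fibre_order; case: asboolP => [cx|_].
  by apply: cmin; split => //=; rewrite -mc.
by rewrite mc; apply: bmin; exists x.
Qed.

(** Two points of a fibre have the same predecessors outside that fibre: this
    turns countability of initial segments into a property of whole fibres, as
    soon as the fibres are countable. *)
Lemma fibre_order_lt (T : Type) (r : rel T) (m : T -> T) (x y z : T) :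
  m x = m y -> m z <> m x -> fibre_order r m z y -> fibre_order r m z x.
Proof.
move=> mxy nzx; rewrite /fibre_order.
by case: asboolP => [zy|_]; [move: nzx; rewrite mxy|rewrite asboolF// mxy].
Qed.

(** * Borel sets of reals and Borel sets of the Cantor space *)

Definition agree (T : Type) (n : nat) (x y : nat -> T) : Prop :=
  forall i, (i < n)%N -> x i = y i.

Definition cylinders : set (set (nat -> bool)) :=
  [set [set x : nat -> bool | x n] | n in [set: nat]].

Notation cantor_borel := (cylinders.-sigma.-measurable).

Lemma measurable_bit n (b : bool) : cantor_borel [set x | x n = b].
Proof.
have mn : cantor_borel [set x : nat -> bool | x n].
  by apply: sub_sigma_algebra; exists n.
case: b; first exact: mn.
rewrite (_ : [set _ | _] = ~` [set x : nat -> bool | x n]).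
  exact: measurableC.
by apply/seteqP; split => x /=; case: (x n).
Qed.

Lemma measurable_agree n (c : nat -> bool) :
  cantor_borel [set x | agree n x c].
Proof.
rewrite (_ : [set _ | _] = \bigcap_(i in `I_n) [set x | x i = c i]) //.
by apply: bigcap_measurableType => i _; exact: measurable_bit.
Qed.

Section Cut.
Variable R : realType.

Definition rat_enum (n : nat) : rat := odflt 0%R (unpickle n).

Lemma rat_enum_surj (q : rat) : exists n, rat_enum n = q.
Proof. by exists (pickle q); rewrite /rat_enum pickleK. Qed.

(** The set of rationals below [x], as a point of the Cantor space. *)
Definition rat_cut (x : R) (n : nat) : bool := (ratr (rat_enum n) < x)%R.

Lemma cut_inj : injective rat_cut.
Proof.
have lt x y : (x < y)%R -> rat_cut x <> rat_cut y.
  move=> /rat_in_itvoo[q]; have [n <-] := rat_enum_surj q.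
  rewrite in_itv/= => /andP[xq qy] /(congr1 (@^~ n)); rewrite /rat_cut qy.
  by rewrite ltNge (ltW xq).
by move=> x y xy; apply/eqP; case: ltgtP => // /lt; rewrite xy.
Qed.

(** An open ray is the countable union of the open rays with rational endpoint
    that it contains, and these are the preimages of the cylinders. *)
Lemma borel_setsE :
  borel_sets R = preimage_set_system setT rat_cut cantor_borel.
Proof.
have -> : borel_sets R = <<s @RGenOInfty.G R >> := RGenOInfty.measurableE R.
rewrite -g_sigma_preimageE eqEsubset.
split; apply: smallest_sub; try exact: smallest_sigma_algebra.
- move=> _ [x ->].
  pose G n : set R := if (x <= ratr (rat_enum n))%R
    then [set y | (ratr (rat_enum n) < y)%R] else set0.
  rewrite (_ : `]x, +oo[%classic = \bigcup_n G n); last first.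
    apply/seteqP; split => y /=; rewrite in_itv/= andbT.
      move=> /rat_in_itvoo[q]; have [n <-] := rat_enum_surj q.
      by rewrite in_itv/= => /andP[xq qy]; exists n => //; rewrite /G ltW.
    move=> [n _]; rewrite /G; case: ifPn => //= xq; exact: le_lt_trans.
  apply: sigma_algebra_bigcup => n; rewrite /G; case: ifP => _; last first.
    exact: sigma_algebra0.
  apply: sub_sigma_algebra.
  exists [set x : nat -> bool | x n]; first by exists n.
  by rewrite setTI.
- move=> _ [_ [n _ <-] <-]; apply: sub_sigma_algebra.
  exists (ratr (rat_enum n)); rewrite setTI.
  by apply/seteqP; split => y /=; rewrite /rat_cut in_itv/= andbT.
Qed.

Lemma borel_preimage_cut D : cantor_borel D -> borel_sets R (rat_cut @^-1` D).
Proof. by move=> mD; rewrite borel_setsE; exists D; rewrite ?setTI. Qed.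

Lemma borel_cutP B :
  borel_sets R B -> exists2 D, cantor_borel D & B = rat_cut @^-1` D.
Proof. by rewrite borel_setsE => -[D mD <-]; exists D; rewrite ?setTI. Qed.

Lemma borel_countable B : countable B -> borel_sets R B.
Proof. by apply: countable_measurable => x; exact: measurable_set1. Qed.

(** Countable sets being Borel, the sigma-algebra generated by the Borel
    sets and the countable sets is the Borel one. *)
Lemma countable_nonmeasurableE B :
  ideal_nonmeasurable (countable_ideal R) B <-> ~ borel_sets R B.
Proof.
rewrite /ideal_nonmeasurable (_ : <<s _ >> = borel_sets R) //.
rewrite eqEsubset; split.
  apply: smallest_sub; first exact: sigma_algebra_measurable.
  by move=> C [//|/borel_countable].
by move=> C bC; apply: sub_sigma_algebra; left.
Qed.

Lemma real_uncountable : ~ countable [set: R].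
Proof.
move=> /(countable_subset (@subsetT _ `[0%R, 1%R]%classic)).
move=> /countable_lebesgue_measure0.
rewrite lebesgue_measure_itv/= lte_fin ltr01 oppr0 adde0.
by move/eqP; rewrite eqe oner_eq0.
Qed.

End Cut.

(** * There are no more Borel sets than subsets of the natural numbers *)

Inductive borel_code : Type :=
| Cylinder of nat
| Complement of borel_code
| Union of (nat -> borel_code).

Fixpoint decode (c : borel_code) : set (nat -> bool) :=
  match c with
  | Cylinder n => [set x | x n]
  | Complement c => ~` decode c
  | Union f => \bigcup_n decode (f n)
  end.

Lemma decode_surj D : cantor_borel D -> exists c, decode c = D.
Proof.
have : sigma_algebra [set: nat -> bool] [set D | exists c, decode c = D].
  split => [|A [c <-]|A codeA].
  - exists (Complement (Union (fun n => if n is 0 then Cylinder 0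
                                        else Complement (Cylinder 0)))).
    rewrite /= -subset0 => x; apply.
    by have [x0|x0] := pselect (x 0); [exists 0|exists 1].
  - by exists (Complement c); rewrite setTD.
  - have [f fA] := choice codeA; exists (Union f) => /=.
    by apply: eq_bigcupr => n _; rewrite fA.
move=> sa; apply: (@smallest_sub _ _ _ [set D | exists c, decode c = D] sa).
by move=> _ [n _ <-]; exists (Cylinder n).
Qed.

(** A code is a well-founded tree, hence is determined by the function that
    sends a path from the root to the label found at its end. *)
Fixpoint label (c : borel_code) (p : seq nat) : nat :=
  match c, p with
  | Cylinder n, _ => n.+2
  | Complement _, [::] => 0
  | Complement c, _ :: p => label c p
  | Union _, [::] => 1
  | Union f, n :: p => label (f n) p
  end.

Lemma label_inj : injective label.
Proof.
elim=> [n|c IH|f IH] [m|d|g] /[dup] e /(congr1 (@^~ [::])) //=.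
- by case=> ->.
- move=> _; congr Complement; apply: IH; apply/funext => p.
  by have := congr1 (@^~ (0 :: p)) e.
- move=> _; congr Union; apply/funext => n; apply: IH; apply/funext => p.
  by have := congr1 (@^~ (n :: p)) e.
Qed.

Definition graph_code (I : countType) (h : I -> nat) (n : nat) : bool :=
  if unpickle n is Some (i, v) then h i == v else false.

Lemma graph_code_inj (I : countType) : injective (@graph_code I).
Proof.
move=> h k /(congr1 (@^~ (pickle (_, _))))hk; apply/funext => i.
by have := hk _ _ i (h i); rewrite /graph_code pickleK eqxx => /esym/eqP.
Qed.

Lemma injective_left_inverse (I T : Type) (f : I -> T) (i0 : I) :
  injective f -> exists g, cancel f g.
Proof.
move=> f_inj.
have /choice[g gP] t : exists i, forall j, f j = t -> j = i.
  have [[i <-]|nt] := pselect (exists i, f i = t).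
    by exists i => j /f_inj.
  by exists i0 => j ft; case: nt; exists j.
by exists g => i; rewrite -(gP (f i) i).
Qed.

Lemma real_enumeration (R : realType) :
  exists e : (nat -> bool) -> R, forall x, exists c, e c = x.
Proof.
have [e eK] := injective_left_inverse 0%R (@cut_inj R).
by exists e => x; exists (rat_cut x); rewrite eK.
Qed.

Lemma borel_enumeration (R : realType) :
  exists e : (nat -> bool) -> set R,
    forall B, borel_sets R B -> exists c, e c = B.
Proof.
have code_inj : injective (@graph_code (seq nat) \o label).
  by move=> c d /graph_code_inj/label_inj.
have [e eK] := injective_left_inverse (Cylinder 0) code_inj.
exists (fun c => @rat_cut R @^-1` decode (e c)).
move=> _ /borel_cutP[D /decode_surj[c <-] ->].
by exists (graph_code (label c)); rewrite [e _](eK c).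
Qed.

(** * Analytic sets *)

(** Closedness of a relation in the product topology, spelled out on
    finite approximations. *)
Definition closed_rel (T U : Type) (K : (nat -> T) -> (nat -> U) -> Prop) :=
  forall x y, (forall n, exists x' y', [/\ agree n x x', agree n y y' & K x' y'])
  -> K x y.

Definition analytic (D : set (nat -> bool)) : Prop :=
  exists2 K : (nat -> bool) -> (nat -> nat) -> Prop, closed_rel K &
    forall x, D x <-> exists y, K x y.

Lemma analytic_bit n (b : bool) : analytic [set x | x n = b].
Proof.
exists (fun x _ => x n = b); last by move=> x; split=> [|[]] // xn; exists id.
by move=> x y /(_ n.+1)[x' [y' [xx' _ <-]]]; exact: xx'.
Qed.

Lemma analytic_set0 : analytic set0.
Proof.
by exists (fun _ _ => False) => [x y /(_ 0)[? [? []]]//|x]; split=> // -[].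
Qed.

Lemma analytic_setT : analytic setT.
Proof. by exists (fun _ _ => True) => // x; split=> // _; exists id. Qed.

(** The first value of the witness names the set of the family in which the
    point lies, and its other values form a witness for that set. *)
Lemma analytic_bigcup (D : nat -> set (nat -> bool)) :
  (forall n, analytic (D n)) -> analytic (\bigcup_n D n).
Proof.
move=> aD; have /choice[K KP] n : exists K, closed_rel K /\
    forall x, D n x <-> exists y : nat -> nat, K x y.
  by have [K ? ?] := aD n; exists K.
exists (fun x y => K (y 0) x (y \o S)) => [x y apx|x].
  apply: (KP _).1 => n; have [x' [y' [xx' yy']]] := apx n.+1.
  rewrite -(yy' 0)// => Kxy; exists x', (y' \o S); split => //.
  - by move=> i ni; apply: xx'; rewrite ltnS ltnW.
  - by move=> i ni; exact: yy'.
split=> [[n _ /(KP n).2[y Kxy]]|[y Kxy]].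
  by exists (fun i => if i is j.+1 then y j else n).
by exists (y 0) => //; apply/(KP _).2; exists (y \o S).
Qed.

(** One witness packs countably many, through a bijection between
    [nat * nat] and [nat]. *)
Lemma analytic_bigcap (D : nat -> set (nat -> bool)) :
  (forall n, analytic (D n)) -> analytic (\bigcap_n D n).
Proof.
move=> aD; have /choice[K KP] n : exists K, closed_rel K /\
    forall x, D n x <-> exists y : nat -> nat, K x y.
  by have [K ? ?] := aD n; exists K.
pose row (y : nat -> nat) (i : nat) := fun j : nat => y (pickle (i, j)).
exists (fun x y => forall i, K i x (row y i)) => [x y apx i|x].
  apply: (KP _).1 => n.
  have [N nN] : exists N, forall j, (j < n)%N -> (maxn n (pickle (i, j)) <= N)%N.
    exists (\max_(j < n) maxn n (pickle (i, nat_of_ord j))) => j jn.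
    exact: (leq_bigmax (Ordinal jn)).
  have [x' [y' [xx' yy' Kxy]]] := apx N.+1; exists x', (row y' i); split => //.
  - by move=> j jn; apply: xx'; have := nN j jn; lia.
  - by move=> j jn; apply: yy'; have := nN j jn; lia.
split=> [Dx|[y Kxy] i _].
  have /choice[y Ky] i : exists y, K i x y by apply/(KP i).2; exact: Dx.
  pose z n := if unpickle n is Some (i, j) then y i j else 0.
  exists z => i; suff -> : row z i = y i by exact: Ky.
  by apply/funext => j; rewrite /row /z pickleK.
by apply/(KP i).2; exists (row y i).
Qed.

Lemma analytic_setI D E : analytic D -> analytic E -> analytic (D `&` E).
Proof.
by move=> aD aE; rewrite -bigcap2E; apply: analytic_bigcap => -[|[|n]] //;
  exact: analytic_setT.
Qed.

(** The sets that are analytic together with their complement form a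
    sigma-algebra, by the closure of analytic sets under countable unions and
    countable intersections. *)
Lemma cantor_borel_analytic D : cantor_borel D -> analytic D.
Proof.
pose bianalytic := [set D | analytic D /\ analytic (~` D)].
suff sub : <<s cylinders >> `<=` bianalytic by move=> /sub[].
apply: smallest_sub; last first.
  move=> _ [n _ <-]; split; first exact: analytic_bit n true.
  rewrite (_ : ~` _ = [set x : nat -> bool | x n = false]).
    exact: analytic_bit.
  by apply/seteqP; split => x /=; case: (x n).
split=> [|A [aA aA']|A aA].
- by split; [exact: analytic_set0|rewrite setC0; exact: analytic_setT].
- by rewrite setTD; split=> //; rewrite setCK.
- split; first by apply: analytic_bigcup => n; case: (aA n).
  by rewrite setC_bigcup; apply: analytic_bigcap => n; case: (aA n).
Qed.

(** * The perfect set theorem *)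

Lemma prefix_nth_size (T : eqType) (a : T) (s t : seq T) : prefix s t ->
  (size s <= size t)%N /\ forall i, (i < size s)%N -> nth a s i = nth a t i.
Proof.
move=> /prefixP[u ->]; rewrite size_cat leq_addr; split=> // i ilt.
by rewrite nth_cat ilt.
Qed.

Section PerfectSet.
Variable D : set (nat -> bool).
Variable K : (nat -> bool) -> (nat -> nat) -> Prop.
Hypothesis K_closed : closed_rel K.
Hypothesis DK : forall x, D x <-> exists y, K x y.

Implicit Types s t : seq (bool * nat).

Definition zip_fun (x : nat -> bool) (y : nat -> nat) i := (x i, y i).

(** The part of [D] that has a witness compatible with the finite
    approximation [s] of a pair (point, witness). *)
Definition approx_part s : set (nat -> bool) :=
  [set x | exists2 y, K x y & s = mkseq (zip_fun x y) (size s)].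

Definition big s : Prop := ~ countable (approx_part s).

Definition approx_bit s n : bool := (nth (false, 0) s n).1.

(** The parts of the non-big approximations are countably many countable
    sets. If any two big extensions of [s] had compatible bits, at most one point
    of [approx_part s] could remain outside them, and [approx_part s] would be countable. *)
Lemma big_split s : big s -> exists t0 t1 n,
  [/\ prefix s t0 /\ prefix s t1, big t0 /\ big t1,
      (n < size t0)%N /\ (n < size t1)%N &
      approx_bit t0 n = false /\ approx_bit t1 n = true].
Proof.
move=> big_s; apply: contrapT => nsplit; apply: big_s.
pose small := \bigcup_(t in [set t | countable (approx_part t)]) approx_part t.
have c_small : countable small by apply: bigcup_countable.
have uniq_rest x x' : approx_part s x -> approx_part s x' -> ~ small x ->
    ~ small x' -> forall n, x n = false -> x' n = true -> False.
  move=> [y Kxy sE] [y' Kxy' sE'] nx nx' n xn xn'; apply: nsplit.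
  have ext z w : K z w -> ~ small z -> s = mkseq (zip_fun z w) (size s) ->
      let t := mkseq (zip_fun z w) (size s + n.+1) in
      [/\ prefix s t, big t, (n < size t)%N & approx_bit t n = z n].
    move=> Kzw nz sz t; split.
    - rewrite prefixE /t /mkseq -map_take take_iota (minn_idPl _) ?leq_addr//.
      exact/eqP/esym.
    - by move=> ct; apply: nz; exists t => //; exists w; rewrite ?size_mkseq.
    - by rewrite size_mkseq; lia.
    - by rewrite /approx_bit nth_mkseq//; lia.
  have [p0 b0 n0 e0] := ext _ _ Kxy nx sE.
  have [p1 b1 n1 e1] := ext _ _ Kxy' nx' sE'.
  by do 3 eexists; split; split; [exact: p0|exact: p1|exact: b0|exact: b1|
    exact: n0|exact: n1|rewrite e0|rewrite e1].
have [[x [sx nx]]|none] := pselect (exists x, approx_part s x /\ ~ small x).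
  apply: (@countable_subset _ _ (small `|` [set x])).
    move=> z sz; have [zs|nz] := pselect (small z); [by left|right].
    apply/funext => n; case xn: (x n); case zn: (z n) => //; exfalso.
    - exact: (uniq_rest z x sz sx nz nx n).
    - exact: (uniq_rest x z sx sz nx nz n).
  by apply: countable_setU => //; exact: countable1.
apply: (countable_subset _ c_small) => x sx.
by apply: contrapT => nx; apply: none; exists x.
Qed.

Hypothesis D_uncountable : ~ countable D.

Lemma big_nil : big [::].
Proof.
rewrite /big (_ : approx_part [::] = D) //.
by apply/seteqP; split=> x; rewrite DK => -[y]; exists y.
Qed.

Variable split_node : seq (bool * nat) -> bool -> seq (bool * nat).
Variable split_pos : seq (bool * nat) -> nat.
Hypothesis split_nodeP : forall s, big s -> forall b,
  [/\ prefix s (split_node s b), big (split_node s b),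
      (split_pos s < size (split_node s b))%N &
      approx_bit (split_node s b) (split_pos s) = b].

(** The tree obtained by iterating the splitting [split_node]; its nodes are
    indexed by finite sequences of choices, the last choice at the end. *)
Definition node (w : seq bool) : seq (bool * nat) := foldl split_node [::] w.

Lemma node_rcons w b : node (rcons w b) = split_node (node w) b.
Proof. by rewrite /node foldl_rcons. Qed.

Lemma node_big w : big (node w).
Proof.
elim/last_ind: w => [|w b IH]; first exact: big_nil.
by rewrite node_rcons; have [] := split_nodeP IH b.
Qed.

Lemma node_prefix w v : prefix (node w) (node (w ++ v)).
Proof.
elim/last_ind: v => [|v b IH]; first by rewrite cats0 prefix_refl.
rewrite -rcons_cat node_rcons.
have [+ _ _ _] := split_nodeP (@node_big (w ++ v)) b.
exact: prefix_trans.
Qed.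

(** Both extensions agree with [s] below [size s], so they can only differ
    beyond; this is what makes the tree grow. *)
Lemma split_pos_ge s : big s -> (size s <= split_pos s)%N.
Proof.
move=> bs; have [pre0 _ _ bit0] := split_nodeP bs false.
have [pre1 _ _ bit1] := split_nodeP bs true.
have [_ nth0] := prefix_nth_size (false, 0) pre0.
have [_ nth1] := prefix_nth_size (false, 0) pre1.
rewrite leqNgt; apply/negP => lt; move: bit1.
by rewrite /approx_bit -nth1// nth0// -/(approx_bit _ _) bit0.
Qed.

Lemma size_node w : (size w <= size (node w))%N.
Proof.
elim/last_ind: w => [//|w b IH]; rewrite size_rcons node_rcons.
have [_ _ + _] := split_nodeP (@node_big w) b.
by apply: leq_ltn_trans; exact: leq_trans IH (split_pos_ge (@node_big w)).
Qed.

Definition branch (b : nat -> bool) (i : nat) : bool * nat :=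
  nth (false, 0) (node (mkseq b i.+1)) i.

Definition branch_point (b : nat -> bool) (i : nat) : bool := (branch b i).1.

Lemma branchE b k i : (i < size (node (mkseq b k)))%N ->
  nth (false, 0) (node (mkseq b k)) i = branch b i.
Proof.
have mono m n : (m <= n)%N -> prefix (node (mkseq b m)) (node (mkseq b n)).
  by move=> /subnKC <-; rewrite /mkseq iotaD map_cat; exact: node_prefix.
move=> ik; have ii : (i < size (node (mkseq b i.+1)))%N.
  by apply: leq_trans (size_node _); rewrite size_mkseq.
have [le|/ltnW le] := leqP k i.+1.
  exact: (prefix_nth_size (false, 0) (mono _ _ le)).2.
by apply/esym; exact: (prefix_nth_size (false, 0) (mono _ _ le)).2.
Qed.

Lemma branch_bitE b k i : (i < size (node (mkseq b k)))%N ->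
  approx_bit (node (mkseq b k)) i = branch_point b i.
Proof. by move=> ik; rewrite /approx_bit branchE. Qed.

(** Every node is the approximation of some pair of [K], so closedness puts the
    limit of the nodes in [K]. *)
Lemma branch_point_in b : D (branch_point b).
Proof.
apply/DK; exists (fun i => (branch b i).2); apply: K_closed => n.
have [x' [y' Kxy' sE]] : approx_part (node (mkseq b n)) !=set0.
  by apply/set0P/eqP => e; apply: (@node_big (mkseq b n)); rewrite e.
exists x', y'; have eqz i : (i < n)%N -> branch b i = (x' i, y' i).
  move=> ltin; have lti : (i < size (node (mkseq b n)))%N.
    by apply: leq_trans (size_node _); rewrite size_mkseq.
  by rewrite -(branchE lti) sE nth_mkseq.
by split => // i ltin; rewrite /branch_point eqz.
Qed.

(** Recovers the [k]-th step of a branch from the limit point alone: the points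
    that follow some node of depth [k.+1] whose last step is [true]. *)
Definition branch_bit (k : nat) : set (nat -> bool) :=
  \bigcup_(w in [set w : seq bool | size w = k])
    [set x | agree (size (node (rcons w true))) x
                   (approx_bit (node (rcons w true)))].

Lemma measurable_branch_bit k : cantor_borel (branch_bit k).
Proof.
rewrite /branch_bit bigcup_mkcond; apply: countable_bigcupT_measurable.
  exact: countableP.
by move=> w; case: ifP => _; [exact: measurable_agree|exact: measurable0].
Qed.

Lemma branch_bitP b k : branch_bit k (branch_point b) <-> b k.
Proof.
split=> [[w /= sw bw]|bk]; last first.
  exists (mkseq b k); first by rewrite /= size_mkseq.
  rewrite -[true in rcons _ true]bk -mkseqS => i ilt.
  by rewrite branch_bitE.
have [c wE] : exists c : nat -> bool, rcons w true = mkseq c k.+1.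
  exists (nth false (rcons w true)); rewrite -sw -(size_rcons w true).
  by rewrite mkseq_nth.
have ck : c k by have := congr1 (last false) wE; rewrite mkseqS !last_rcons.
rewrite {}wE in bw.
suff bc n : (n <= k)%N -> b n = c n by rewrite bc.
(* at the first node where the two branches separate, they go on with opposite
   values at the splitting position *)
elim/ltn_ind: n => n IH nk; set s := node (mkseq c n).
have bcn : mkseq b n = mkseq c n.
  by apply/eq_in_map => i; rewrite mem_iota /= => lt; apply: IH; lia.
have nb : split_node s (b n) = node (mkseq b n.+1).
  by rewrite mkseqS node_rcons bcn.
have nc : split_node s (c n) = node (mkseq c n.+1) by rewrite mkseqS node_rcons.
have [_ _] := split_nodeP (@node_big (mkseq c n)) (b n); rewrite nb => lt <-.
have [_ _] := split_nodeP (@node_big (mkseq c n)) (c n); rewrite nc => lt' <-.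
have ltk : (split_pos s < size (node (mkseq c k.+1)))%N.
  have := node_prefix (mkseq c n.+1) [seq c i | i <- iota n.+1 (k - n)].
  rewrite -map_cat -iotaD (_ : n.+1 + _ = k.+1); last by lia.
  by move=> /(prefix_nth_size (false, 0))[+ _]; exact: leq_trans.
by rewrite branch_bitE// bw// !branch_bitE.
Qed.

End PerfectSet.

(** The sets [U k] make the inverse of [g] Borel, which gives the injectivity of
    [g] as well as disjoint Borel sets that split its range. *)
Lemma analytic_perfect (D : set (nat -> bool)) : analytic D -> ~ countable D ->
  exists (g : (nat -> bool) -> nat -> bool) (U : nat -> set (nat -> bool)),
    [/\ forall k, cantor_borel (U k), forall b, D (g b) &
        forall b k, U k (g b) <-> b k].
Proof.
move=> [K K_closed DK] D_unc.
have /choice[f fP] s : exists p : (bool -> seq (bool * nat)) * nat,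
    big K s -> forall b, [/\ prefix s (p.1 b), big K (p.1 b),
      (p.2 < size (p.1 b))%N & approx_bit (p.1 b) p.2 = b].
  have [bs|nbs] := pselect (big K s); last by exists (fun=> [::], 0).
  have [t0 [t1 [n [pre bt lt e]]]] := big_split bs.
  by exists (fun b => if b then t1 else t0, n) => _ [];
    case: pre bt lt e => [p0 p1] [b0 b1] [n0 n1] [e0 e1].
exists (branch_point (fun s => (f s).1)), (branch_bit (fun s => (f s).1)).
split.
- exact: measurable_branch_bit.
- exact: (branch_point_in K_closed DK D_unc fP).
- exact: (branch_bitP DK D_unc fP).
Qed.

(** * The perfect set theorem for the reals *)

Section RealPerfectSet.
Variable R : realType.

(** This exhibits the cuts as an analytic set: [x] is the cut of a real when it
    is a down-set that is neither empty nor full and has no greatest element;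
    the witness [y] names a member at [0], a non-member at [1], and at [n.+2] a
    member above the [n]-th rational when that one is a member. *)
Definition cut_witness (x : nat -> bool) (y : nat -> nat) : Prop :=
  [/\ forall n m, (rat_enum m <= rat_enum n)%R -> x n -> x m,
      x (y 0) = true, x (y 1) = false &
      forall n, x n -> (rat_enum n < rat_enum (y n.+2))%R /\ x (y n.+2)].

Lemma cut_witness_closed : closed_rel cut_witness.
Proof.
move=> x y apx.
have {}apx N : exists x' y', [/\ forall i, (i <= N)%N -> x' i = x i,
    forall i, (i <= N)%N -> y' i = y i & cut_witness x' y'].
  have [x' [y' [xx' yy' w]]] := apx N.+1; exists x', y'.
  by split => // i iN; rewrite ?xx' ?yy'.
split.
- move=> n m mn; have [x' [y' [xx' _ [w _ _ _]]]] := apx (n + m).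
  by rewrite -!xx' ?leq_addr ?leq_addl//; exact: w.
- have [x' [y' [xx' yy' [_ w _ _]]]] := apx (y 0).
  by rewrite -xx'// -yy'.
- have [x' [y' [xx' yy' [_ _ w _]]]] := apx (y 1).+1.
  by rewrite -xx'// -yy'.
- move=> n; have [x' [y' [xx' yy' [_ _ _ w]]]] := apx (n.+2 + y n.+2).
  rewrite -(xx' n); last by lia.
  by move=> /w; rewrite yy' ?xx' ?leq_addr ?leq_addl.
Qed.

Lemma cut_witnessP (x : nat -> bool) :
  [set rat_cut a | a in [set: R]] x <-> exists y, cut_witness x y.
Proof.
have ratP (a b : R) : (a < b)%R -> exists n, (a < ratr (rat_enum n) < b)%R.
  move=> /rat_in_itvoo[q]; have [n <-] := rat_enum_surj q.
  by rewrite in_itv /= => ?; exists n.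
split=> [[a _ <-]|[y [down x0 x1 up]]].
  have [n0 /andP[_ n0a]] := ratP (a - 1)%R a ltac:(by rewrite ltrBlDr ltrDl).
  have [n1 /andP[an1 _]] := ratP a (a + 1)%R ltac:(by rewrite ltrDl).
  have /choice[f fP] n : exists m, rat_cut a n ->
      (rat_enum n < rat_enum m)%R /\ rat_cut a m.
    have [/ratP[m /andP[nm ma]]|na] := boolP (rat_cut a n); last by exists 0.
    by exists m; rewrite -(ltr_rat R).
  exists (fun i => match i with 0 => n0 | 1 => n1 | i.+2 => f i end).
  split => //= [n m mn|].
  - by rewrite /rat_cut; apply: le_lt_trans; rewrite ler_rat.
  - by apply/negbTE; rewrite /rat_cut -leNgt ltW.
pose E := [set (ratr (rat_enum n) : R)%R | n in [set n | x n]].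
have supE : has_sup E.
  split; first by exists (ratr (rat_enum (y 0))), (y 0).
  exists (ratr (rat_enum (y 1))) => _ [n /= xn <-].
  rewrite ler_rat leNgt; apply/negP => /ltW /down /(_ xn).
  by rewrite x1.
exists (sup E) => //; apply/funext => n; apply/idP/idP; rewrite /rat_cut.
  move=> lt; have [] := @sup_adherent _ E (sup E - ratr (rat_enum n))%R _ supE.
    by rewrite subr_gt0.
  move=> _ [m /= xm <-]; rewrite subKr ltr_rat => /ltW nm.
  exact: down nm xm.
move=> xn; have [lt xm] := up n xn.
apply: (@lt_le_trans _ _ (ratr (rat_enum (y n.+2)))); first by rewrite ltr_rat.
by apply: (ub_le_sup supE.2); exists (y n.+2).
Qed.

Lemma cut_range_analytic : analytic [set rat_cut a | a in [set: R]].
Proof.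
by exists cut_witness; [exact: cut_witness_closed|exact: cut_witnessP].
Qed.

Lemma borel_perfect (B : set R) : borel_sets R B -> ~ countable B ->
  exists (g : (nat -> bool) -> R) (U : nat -> set R),
    [/\ forall k, borel_sets R (U k), forall b, B (g b) &
        forall b k, U k (g b) <-> b k].
Proof.
move=> /borel_cutP[D /cantor_borel_analytic aD ->] ncB.
have aDI := analytic_setI aD cut_range_analytic.
have [|g [U [mU gD gU]]] := analytic_perfect aDI.
  apply: contra_not ncB; apply: sub_countable.
  apply: (@set_inj_card_le _ _ _ _ (@rat_cut R)) => [x y _ _|x Dx].
    exact: cut_inj.
  by split => //; exists x.
have /choice[h hP] : forall b, exists x : R, rat_cut x = g b.
  by move=> b; have [_ [x _ <-]] := gD b; exists x.
exists h, (fun k => @rat_cut R @^-1` U k); split => [k|b|b k].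
- exact: borel_preimage_cut.
- by rewrite /= hP; have [] := gD b.
- by rewrite /= hP.
Qed.

(** In a perfect set inside [R], the bits of even rank are Borel functions of
    the point, so fixing all of them to [f] defines a Borel set; that set is
    uncountable because the bits of odd rank remain free. *)
Lemma continuum_many_borel : exists B : (nat -> bool) -> set R,
  [/\ forall f, borel_sets R (B f), forall f, ~ countable (B f) &
      forall f h x, B f x -> B h x -> f = h].
Proof.
have [g [U [bU _ gU]]] := borel_perfect (@measurableT _ (measurableTypeR R))
  (@real_uncountable R).
exists (fun f => [set x | forall n, U n.*2 x <-> f n]); split.
- move=> f; rewrite (_ : [set _ | _] =
      \bigcap_n (if f n then U n.*2 else ~` U n.*2)).
    apply: (@bigcapT_measurable _ (measurableTypeR R)) => n.
    by case: ifP => _; [exact: bU|apply: measurableC; exact: bU].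
  apply/seteqP; split => x /= Ux n => [_|].
    by case: ifPn => [fn|/negP nf]; [exact/Ux|move=> /Ux].
  by have := Ux n I; case: ifP.
- move=> f cB; apply: (@real_uncountable R).
  pose mix (h : nat -> bool) n := if odd n then h n./2 else f n./2.
  have gmix_inj : injective (g \o mix \o @rat_cut R).
    move=> x y /= gxy; apply: (@cut_inj R); apply/funext => n.
    have bitE z : U n.*2.+1 (g (mix (rat_cut z))) <-> rat_cut z n.
      by rewrite gU /mix /= odd_double /= uphalf_double.
    by apply/idP/idP => /bitE; [rewrite gxy|rewrite -gxy] => /bitE.
  apply: sub_countable cB.
  apply: (@set_inj_card_le _ _ _ _ (g \o mix \o @rat_cut R)) => [x y _ _|x _ n].
    exact: gmix_inj.
  by rewrite /= gU /mix odd_double doubleK.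
- move=> f h x Bf Bh; apply/funext => n.
  by apply/idP/idP => [/Bf/Bh|/Bh/Bf].
Qed.

End RealPerfectSet.

(** * Sets that meet every uncountable Borel set *)

Section Bernstein.
Variable R : realType.

Definition meets_borel (X : set R) : Prop :=
  forall B, borel_sets R B -> ~ countable B -> X `&` B !=set0.

(** If the trace of [X] on [B] were Borel, then one of the Borel sets [X `&` B]
    and [B `\` X] would be uncountable, although it misses the complement of [X]
    or [X] itself. *)
Lemma meets_borel_completely (X : set R) :
  meets_borel X -> meets_borel (~` X) ->
  completely_ideal_nonmeasurable (countable_ideal R) X.
Proof.
move=> meX meXC B bB ncB; apply/countable_nonmeasurableE => bXB.
have bBX : borel_sets R (B `\` X).
  rewrite (_ : B `\` X = B `\` (X `&` B)).
    exact: (@measurableD _ (measurableTypeR R)).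
  by apply/seteqP; split => x /= [Bx nX]; split => //;
      [case|move=> Xx; apply: nX].
have [cXB|/(meXC _ bXB)[x [nXx []//]]] := pselect (countable (X `&` B)).
have [cBX|/(meX _ bBX)[x [Xx [_]]]//] := pselect (countable (B `\` X)).
apply: ncB; apply: countable_subset (countable_setU cXB cBX) => x Bx.
by have [Xx|nXx] := pselect (X x); [left|right].
Qed.

Lemma completely_meets_borel (X : set R) :
  completely_ideal_nonmeasurable (countable_ideal R) X -> meets_borel X.
Proof.
move=> cX B bB ncB; apply/set0P/eqP => XB0.
have /countable_nonmeasurableE := cX B bB ncB; rewrite XB0; apply.
exact: (@measurable0 _ (measurableTypeR R)).
Qed.

Lemma completely_nonmeasurable (X : set R) :
  completely_ideal_nonmeasurable (countable_ideal R) X ->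
  ideal_nonmeasurable (countable_ideal R) X.
Proof.
move=> /(_ setT); rewrite setIT; apply.
  exact: (@measurableT _ (measurableTypeR R)).
exact: real_uncountable.
Qed.

(** A Borel set contains a perfect set, and a set that meets all uncountable
    Borel sets picks a point in each of continuum many disjoint ones. *)
Lemma continuum_le (X : set R) : ~ countable X ->
  borel_sets R X \/ meets_borel X -> [set: nat -> bool] #<= X.
Proof.
move=> ncX [/borel_perfect /(_ ncX)[g [U [_ gX gU]]]|meX].
  apply: (@set_inj_card_le _ _ _ _ g) => // b c _ _ gbc; apply/funext => k.
  by apply/idP/idP => /gU; [rewrite gbc|rewrite -gbc] => /gU.
have [B [bB ncB disj]] := continuum_many_borel R.
have /choice[f fP] b : exists x, (X `&` B b) x by exact: meX.
apply: (@set_inj_card_le _ _ _ _ f) => [b c _ _ fbc|b _].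
  by apply: (disj _ _ (f b)); [exact: (fP b).2|rewrite fbc; exact: (fP c).2].
exact: (fP b).1.
Qed.

(** * From the partition to the continuum hypothesis *)

(** Take the points with countably many predecessors in a well-order of [R] that
    keeps each block convex: two points of a block have the same predecessors up
    to the block itself, which is countable, so these points form a union of
    blocks. *)
Lemma aleph1_saturated (P : set (set R)) :
  P `<=` countable_ideal R -> partition P id [set: R] ->
  exists2 A, A `<=` P & ~ countable (\bigcup_(X in A) X) /\
    has_card_aleph1 (\bigcup_(X in A) X).
Proof.
move=> cP [covP disjP neP].
have /choice[block blockP] (x : R) : exists X, P X /\ X x.
  by have : cover P id x by [rewrite covP]; move=> [X PX Xx]; exists X.
have blockE x X : P X -> X x -> block x = X.
  move=> PX Xx; have [Pb bx] := blockP x.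
  by apply: disjP => //; exists x.
have /choice[rep repP] (X : set R) : exists x, P X -> X x.
  have [PX|nPX] := pselect (P X); last by exists 0%R.
  by have [x Xx] := neP X PX; exists x.
pose m x := rep (block x).
have block_m x : block (m x) = block x.
  by have [Pb _] := blockP x; apply: blockE => //; exact: repP.
have mE x y : m x = m y <-> block x = block y.
  by split=> [mxy|]; [rewrite -block_m mxy block_m|rewrite /m => ->].
have [r wo] := wochoice.well_ordering_principle R.
have [ncS S1] := well_order_aleph1 (fibre_order_wo m wo) (@real_uncountable R).
set S := [set x | _] in ncS S1.
suff SE : S = \bigcup_(X in [set block x | x in S]) X.
  exists [set block x | x in S]; last by rewrite -SE.
  by move=> _ [x _ <-]; exact: (blockP x).1.
apply/seteqP; split => [x Sx|y [_ [x Sx <-] xy]].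
  by exists (block x); [exists x|exact: (blockP x).2].
have bxy : block y = block x by apply: blockE => //; exact: (blockP x).1.
apply: (@countable_subset _ _ ([set z | fibre_order r m z x] `|` block x)).
  move=> z /= zy; have [mzx|mzx] := pselect (m z = m x).
    by right; rewrite -(mE z x).1//; exact: (blockP z).2.
  by left; apply: (@fibre_order_lt _ _ _ x y) => //; exact/mE.
by apply: countable_setU => //; apply: cP; exact: (blockP x).1.
Qed.

Lemma partition_continuum_hypothesis (P : set (set R)) :
  P `<=` countable_ideal R -> partition P id [set: R] ->
  (forall A, A `<=` P ->
    ideal_nonmeasurable (countable_ideal R) (\bigcup_(X in A) X) ->
    completely_ideal_nonmeasurable (countable_ideal R) (\bigcup_(X in A) X)) ->
  continuum_hypothesis.
Proof.
move=> cP partP nonmP.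
have [A AP [ncX [T [r [r1 XT]]]]] := aleph1_saturated cP partP.
exists T, r; split => //; apply: card_eq_trans XT.
apply: Cantor_Bernstein.
  apply: (continuum_le ncX).
  have [|nbX] := pselect (borel_sets R (\bigcup_(X in A) X)); [by left|right].
  apply/completely_meets_borel/nonmP => //.
  exact/countable_nonmeasurableE.
by apply: (@set_inj_card_le _ _ _ _ (@rat_cut R)) => // x y _ _; exact: cut_inj.
Qed.

(** * From the continuum hypothesis to the partition *)

(** Transfinite recursion along [r]: the block of rank [t] contains a new point
    of each [E s] with [s] below [t], and the point [e t] if no earlier block
    contains it. *)
Lemma omega1_blocks (X T : Type) (r : rel T) (e : T -> X) (E : T -> set X) :
  omega1_order r -> (forall x, exists t, e t = x) ->
  (forall t, ~ countable (E t)) ->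
  exists Q : T -> set X,
    [/\ forall t, countable (Q t), forall s t x, Q s x -> Q t x -> s = t,
        forall x, exists t, Q t x &
        forall s t, r s t -> E s `&` Q t !=set0].
Proof.
move=> [wo _ c_init] e_surj ncE.
have /choice[new newP] (p : T * set X) :
    exists x, countable p.2 -> (E p.1 `\` p.2) x.
  have [[x Ex]|none] := pselect (exists x, (E p.1 `\` p.2) x); first by exists x.
  (* here [E p.1] is included in [p.2], which is thus uncountable *)
  exists (e p.1) => cU; case: (ncE p.1); apply: countable_subset cU => x Ex.
  by apply: contrapT => nx; apply: none; exists x.
pose block t (U : set X) : set X :=
  ([set e t] `\` U) `|` [set new (s, U) | s in [set s | r s t]].
pose step t (Q : forall s, ~ r t s -> set X) :=
  block t [set x | exists s (st : ~ r t s), Q s st x].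
pose Q := Fix (well_order_wf wo) (fun=> set X) step.
pose U t := \bigcup_(s in [set s | ~ r t s]) Q s.
have QE t : Q t = block t (U t).
  rewrite /Q Fix_eq -/Q.
    by congr block; apply/seteqP; split => x [s]; [move=> [st Qx]|move=> st Qx];
      exists s => //; exists st.
  move=> s f g fg; congr block; apply/funext => x; apply/propext.
  by split => -[u [us]] h; exists u, us; [rewrite -fg|rewrite fg].
have cQ t : countable (Q t).
  elim/(well_founded_ind (well_order_wf wo)): t => t IH.
  rewrite QE; apply: countable_setU.
    apply: (@countable_subset _ _ [set e t]); first exact: subDsetl.
    exact: countable1.
  by apply: sub_countable (c_init t); exact: card_image_le.
have cU t : countable (U t).
  apply: bigcup_countable => //; apply: countable_subset (c_init t) => s /= nts.
  by have := well_order_total wo s t; case: (r t s) nts; rewrite ?orbF.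
have QU t x : Q t x -> ~ U t x.
  rewrite QE => -[[_]//|[s _ <-]].
  by have [] := newP (s, U t) (cU t).
exists Q; split => //.
- have wlg s t x : r s t -> Q s x -> Q t x -> s = t.
    move=> st Qs /QU nU; apply: contrapT => nst; apply: nU; exists s => //= ts.
    by apply: nst; apply: (well_order_anti wo); rewrite st ts.
  move=> s t x Qs Qt; have /orP[st|ts] := well_order_total wo s t.
    exact: wlg Qs Qt.
  by apply/esym; exact: wlg Qt Qs.
- move=> x; have [t <-] := e_surj x.
  have [[s _ Qs]|nU] := pselect (U t (e t)); first by exists s.
  by exists t; rewrite QE; left.
- move=> s t st; exists (new (s, U t)); split.
    by have [] := newP (s, U t) (cU t).
  by rewrite QE; right; exists s.
Qed.

Lemma continuum_hypothesis_partition : continuum_hypothesis ->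
  exists P : set (set R),
    [/\ P `<=` countable_ideal R,
        partition P id [set: R] &
        forall A : set (set R), A `<=` P ->
          (ideal_nonmeasurable (countable_ideal R) (\bigcup_(X in A) X) <->
           completely_ideal_nonmeasurable (countable_ideal R)
             (\bigcup_(X in A) X))].
Proof.
move=> [T [r [r1 CT]]]; have [wo _ c_init] := r1.
have [c c_surj] : exists c : T -> nat -> bool, forall x, exists t, c t = x.
  have /pcard_surjP[c cS] : [set: nat -> bool] #<= [set: T].
    by move: CT; rewrite card_eq_le => /andP[].
  by exists c => x; have [t _ <-] := cS x I; exists t.
have [e e_surj] := real_enumeration R.
have [E E_surj] := borel_enumeration R.
(* countable sets are replaced by the whole line, for every [F t] has to be
   uncountable *)
pose F t := if `[< countable (E (c t)) >] then setT else E (c t).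
have ncF t : ~ countable (F t).
  by rewrite /F; case: asboolP => // _; exact: real_uncountable.
have F_surj B : borel_sets R B -> ~ countable B -> exists t, F t = B.
  move=> /E_surj[x <-]; have [t <-] := c_surj x => ncE.
  by exists t; rewrite /F asboolF.
have [|Q [cQ disjQ covQ meQ]] := omega1_blocks (e := e \o c) r1 _ ncF.
  by move=> x; have [y <-] := e_surj x; have [t <-] := c_surj y; exists t.
(* an uncountable [J] is unbounded: countable initial segments cannot contain
   it *)
have meets J : ~ countable J -> meets_borel (\bigcup_(t in J) Q t).
  move=> ncJ B bB ncB; have [t <-] := F_surj B bB ncB.
  have [s Js ts] : exists2 s, J s & r t s.
    apply: contrapT => nJ; apply: ncJ; apply: countable_subset (c_init t) => s Js.
    by have /orP[//|ts] := well_order_total wo s t; case: nJ; exists s.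
  by have [x [Fx Qx]] := meQ t s ts; exists x; split => //; exists s.
exists (range Q); split.
- by move=> _ [t _ <-]; exact: cQ.
- split.
  + rewrite /cover -subTset => x _; have [t Qt] := covQ x.
    by exists (Q t) => //; exists t.
  + move=> _ _ [s _ <-] [t _ <-] [x [Qs Qt]].
    by rewrite (disjQ s t x).
  + move=> _ [t _ <-]; have [|x [_ Qx]] := meQ t t; last by exists x.
    exact: well_order_refl.
- move=> A AP; split; last exact: completely_nonmeasurable.
  pose J := [set t | A (Q t)].
  have -> : \bigcup_(X in A) X = \bigcup_(t in J) Q t.
    apply/seteqP; split => [x [X AX]|x [t Jt Qx]]; last by exists (Q t).
    by have [t _ QX] := AP X AX; rewrite -QX in AX *; exists t.
  have CE : ~` (\bigcup_(t in J) Q t) = \bigcup_(t in ~` J) Q t.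
    apply/seteqP; split => [x nx|x [t nJt Qt] [s Js Qs]].
      by have [t Qt] := covQ x; exists t => // Jt; apply: nx; exists t.
    by apply: nJt; rewrite -(disjQ s t x).
  move=> /countable_nonmeasurableE nb; apply: meets_borel_completely.
    apply: meets => cJ; apply: nb; apply: borel_countable.
    exact: bigcup_countable.
  rewrite CE; apply: meets => cJ; apply: nb.
  rewrite -[X in borel_sets R X]setCK.
  apply: (@measurableC _ (measurableTypeR R)).
  by apply: borel_countable; rewrite CE; exact: bigcup_countable.
Qed.

End Bernstein.

Theorem corollary3p8 (R : realType) :
  continuum_hypothesis <->
  exists P : set (set R),
    [/\ P `<=` countable_ideal R,
        partition P id [set: R] &
        forall A : set (set R), A `<=` P ->
          (ideal_nonmeasurable (countable_ideal R) (\bigcup_(X in A) X) <->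
           completely_ideal_nonmeasurable (countable_ideal R)
             (\bigcup_(X in A) X))].
Proof.
split=> [/continuum_hypothesis_partition //|[P [cP partP nonmP]]].
by apply: (partition_continuum_hypothesis cP partP) => A /nonmP[].
Qed.
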